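(* Let $w$ be a non-empty word on the alphabet $\{0,1\}$, let $|w|$ denote its length, let $v_2(w)$ denote its value as a binary expansion, let $N_{w,2}(n)$ be the number of (possibly overlapping) occurrences of $w$ in the binary expansion of $n$, let $\gamma$ be Euler's constant, let $\Gamma$ be the gamma function and let $\Psi = \Gamma'/\Gamma$. (a) If $v_2(w) = 0$, then $$\sum_{n \geq 1} \frac{N_{w,2}(n)}{2n(2n+1)} = \log \Gamma\left(\frac{1}{2^{|w|}}\right) + \frac{\gamma}{2^{|w|}} - |w| \log 2.$$ (b) If $v_2(w) \neq 0$, then $$\sum_{n \geq 1} \frac{N_{w,2}(n)}{2n(2n+1)} = \log \Gamma\left(\frac{v_2(w)+1}{2^{|w|}}\right) - \log \Gamma\left(\frac{v_2(w)}{2^{|w|}}\right) - \frac{1}{2^{|w|}}\Psi\left(\frac{v_2(w)}{2^{|w|}}\right).$$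
   Context: A word on $\{0,1\}$ is a finite block of digits $w = d_1 d_2 \cdots d_k$; its length is $|w| = k$, and $v_2(w) = \sum_{i=1}^k d_i 2^{k-i}$ is the value of $w$ interpreted as a base-2 expansion (possibly with leading $0$'s). For an integer $n>0$, $N_{w,2}(n)$ is the number of (possibly overlapping) occurrences of $w$ as a block of consecutive digits in the binary expansion of $n$. Convention: if $w$ begins with $0$ but $v_2(w) \neq 0$, then in computing $N_{w,2}(n)$ the binary expansion of $n$ is assumed to start with an arbitrarily long prefix of $0$'s; if $v_2(w) = 0$ (i.e. $w$ consists only of $0$'s), the usual binary expansion of $n$ without leading zeros is used. For example $N_{11,2}(7)=2$, $N_{011,2}(3) = 1$ and $N_{0,2}(2)=1$. *)

(* Defs.v *)
(* Stdlib reals with Coquelicot. *)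
From Stdlib Require Import Reals List Bool Arith Lia.
From Coquelicot Require Import Coquelicot.
Import ListNotations.
Local Open Scope nat_scope.

(* Words are read from left to right: the head of the list is the most
   significant digit, and [true] is the digit 1. *)
Definition word : Type := list bool.

Fixpoint v2 (w : word) : nat :=
  match w with
  | [] => 0
  | d :: w' => Nat.b2n d * 2 ^ length w' + v2 w'
  end.

(* For n > 0 there is no leading 0, since [Nat.log2 n] is the position of the
   leading 1; n = 0 would give [[false]] and is never used. *)
Definition binary_expansion (n : nat) : word :=
  map (Nat.testbit n) (rev (seq 0 (S (Nat.log2 n)))).

(* Possibly overlapping occurrences of w in u, counted by starting position.
   Meaningful for w <> []. *)
Fixpoint occurrences (w u : word) : nat :=
  match u with
  | [] => 0
  | _ :: u' =>
      (if list_eq_dec bool_dec (firstn (length w) u) w then 1 else 0)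
      + occurrences w u'
  end.

(* When w begins with 0 and v2 w <> 0, the expansion of n is preceded by an
   arbitrarily long block of 0's. A block of length |w| is long enough, see
   [occurrences_padding] below. *)
Definition padding (w : word) : nat :=
  match w with
  | false :: _ => if Nat.eq_dec (v2 w) 0 then 0 else length w
  | _ => 0
  end.

Definition N2 (w : word) (n : nat) : nat :=
  occurrences w (repeat false (padding w) ++ binary_expansion n).

Lemma v2_repeat_false (k : nat) : v2 (repeat false k) = 0.
Proof. induction k as [|k IH]; simpl; [reflexivity | exact IH]. Qed.

Lemma occurrences_padding (w u : word) (m : nat) :
  v2 w <> 0 -> length w <= m ->
  occurrences w (repeat false m ++ u)
  = occurrences w (repeat false (length w) ++ u).
Proof.
intros hw hm.
induction hm as [|m hm IH]; [reflexivity|].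
rewrite <- IH.
change (repeat false (S m) ++ u) with (false :: (repeat false m ++ u)).
cbn [occurrences].
destruct (list_eq_dec bool_dec _ w) as [e|_]; [|reflexivity].
exfalso; apply hw; rewrite <- e.
replace (false :: (repeat false m ++ u))
  with (repeat false (length w) ++ (repeat false (S m - length w) ++ u)).
- rewrite firstn_app, repeat_length, Nat.sub_diag, firstn_O, app_nil_r.
  rewrite firstn_all2 by (rewrite repeat_length; lia).
  apply v2_repeat_false.
- rewrite app_assoc, <- repeat_app.
  now replace (length w + (S m - length w)) with (S m) by lia.
Qed.

Example N2_11_7 : N2 [true; true] 7 = 2.
Proof. reflexivity. Qed.

Example N2_011_3 : N2 [false; true; true] 3 = 1.
Proof. reflexivity. Qed.

Example N2_0_2 : N2 [false] 2 = 1.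
Proof. reflexivity. Qed.

Local Open Scope R_scope.

(* The limit of 1 + 1/2 + ... + 1/n - ln n, with n = m + 1. *)
Definition euler_gamma : R :=
  real (Lim_seq (fun m : nat =>
    sum_n (fun k : nat => / INR (S k)) m - ln (INR (S m)))).

(* Euler's integral over (0, +oo); only used at x > 0. *)
Definition Gamma (x : R) : R :=
  RInt_gen (fun t : R => Rpower t (x - 1) * exp (- t))
           (at_right 0) (Rbar_locally p_infty).

Definition Psi (x : R) : R := Derive Gamma x / Gamma x.

(* Main.v *)
(* Occurrences of w in m are those in the expansion of m / 2, plus one exactly
   when m is congruent to v2 w modulo q = 2 ^ |w|.  The function
   g(m) = 1/m - ln (1 + 1/m) satisfies g(n) - g(2n) - g(2n+1) = 1/(2n(2n+1)), so
   summation by parts turns the series into the sum of g over the positive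
   integers congruent to v2 w.  With h = 1/q and x = v2 w / q (x = 1 if
   v2 w = 0) this is the sum over j >= 0 of h/(x+j) - ln (1 + h/(x+j)).

   Integrating t^s <= x^s (1 - s + s t/x) against t^(x-1) e^(-t) gives Wendel's
   inequality Gamma (x+s) <= x^s Gamma x for 0 <= s <= 1, hence
   ln Gamma (y+h) - ln Gamma y - h ln y -> 0 as y -> +oo, and the sum above equals
   ln Gamma (x+h) - ln Gamma x - h P(x) with
   P(x) = lim_n (ln (x+n) - sum_(j<n) 1/(x+j)).
   This sum is O(h^2), so P is the derivative of ln Gamma, that is, Psi. *)
Require Import Defs.
From Stdlib Require Import Reals List.
From Coquelicot Require Import Coquelicot.
From Stdlib Require Import Classical Bool Arith Lia Lra.
Import ListNotations.
Local Open Scope nat_scope.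

(** * Occurrences as a digit recurrence *)

Definition indic {P : Prop} (d : {P} + {~ P}) : nat := if d then 1 else 0.

Lemma indic_iff (P Q : Prop) (dP : {P} + {~ P}) (dQ : {Q} + {~ Q}) :
  (P <-> Q) -> indic dP = indic dQ.
Proof. destruct dP, dQ; simpl; tauto. Qed.

(** Truncated subtraction returns all of [u] when [u] is shorter than [w]; the lengths then differ,
    so the block cannot equal [w]. *)
Definition last_block (w u : word) : word := skipn (length u - length w) u.

(** [occurrences] recurses from the most significant digit, whereas halving an integer removes the
    least significant one; this moves the recursion to the other end. *)
Lemma occurrences_snoc (w u : word) (d : bool) :
  w <> [] ->
  occurrences w (u ++ [d])
  = occurrences w u
    + indic (list_eq_dec bool_dec (last_block w (u ++ [d])) w).
Proof.
intros hw.
assert (hk : 1 <= length w) by (destruct w; simpl; [congruence|lia]).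
induction u as [|e u IH].
- simpl. rewrite Nat.add_0_r. apply indic_iff.
  unfold last_block. simpl length.
  replace (1 - length w) with 0 by lia.
  rewrite firstn_all2 by (simpl; lia). reflexivity.
- change ((e :: u) ++ [d]) with (e :: (u ++ [d])).
  cbn [occurrences]. rewrite IH. clear IH.
  fold (indic (list_eq_dec bool_dec (firstn (length w) (e :: u ++ [d])) w)).
  fold (indic (list_eq_dec bool_dec (firstn (length w) (e :: u)) w)).
  (* If [w] fits into [e :: u], the block at the head does not see [d]. Otherwise the only possible
     occurrence is the whole word, which is at once the first and the last block. *)
  destruct (le_lt_dec (length w) (length (e :: u))) as [hle|hlt].
  + rewrite (indic_iff _ (firstn (length w) (e :: u) = w) _
               (list_eq_dec bool_dec (firstn (length w) (e :: u)) w)).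
    * rewrite <- Nat.add_assoc. do 2 f_equal. apply indic_iff.
      unfold last_block. cbn [length] in *.
      replace (S (length (u ++ [d])) - length w)
        with (S (length (u ++ [d]) - length w))
        by (rewrite length_app; cbn [length]; lia).
      reflexivity.
    * change (e :: u ++ [d]) with ((e :: u) ++ [d]).
      rewrite firstn_app.
      replace (length w - length (e :: u)) with 0 by lia.
      rewrite firstn_O, app_nil_r. reflexivity.
  + simpl length in hlt.
    destruct (list_eq_dec bool_dec (firstn (length w) (e :: u)) w) as [h|n].
    { exfalso. rewrite firstn_all2 in h by (simpl; lia).
      apply (f_equal (@length bool)) in h. simpl in h. lia. }
    destruct (list_eq_dec bool_dec (last_block w (u ++ [d])) w) as [h|n'].
    { exfalso. apply (f_equal (@length bool)) in h. unfold last_block in h.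
      rewrite length_skipn, length_app in h. simpl in h. lia. }
    simpl indic. rewrite !Nat.add_0_r, Nat.add_0_l, Nat.add_comm.
    f_equal. apply indic_iff.
    unfold last_block. cbn [length].
    replace (S (length (u ++ [d])) - length w) with 0
      by (rewrite length_app; cbn [length]; lia).
    rewrite firstn_all2 by (simpl; rewrite length_app; simpl; lia).
    reflexivity.
Qed.

(** * Binary values and the halving recurrence *)

Lemma v2_app (u w : word) : v2 (u ++ w) = v2 u * 2 ^ length w + v2 w.
Proof.
induction u as [|d u IH]; simpl; [reflexivity|].
rewrite IH, length_app, Nat.pow_add_r. ring.
Qed.

Lemma v2_lt (w : word) : v2 w < 2 ^ length w.
Proof. induction w as [|[] w IH]; simpl; lia. Qed.

Lemma v2_inj (u w : word) : length u = length w -> v2 u = v2 w -> u = w.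
Proof.
revert w; induction u as [|d u IH]; intros [|e w]; simpl; try discriminate.
- reflexivity.
- intros hl hv. injection hl as hl.
  pose proof (v2_lt u) as hu. pose proof (v2_lt w) as hw. rewrite hl in hu, hv.
  assert (d = e) as -> by (destruct d, e; simpl in hv; [|nia|nia|]; reflexivity).
  f_equal. apply IH; [assumption|lia].
Qed.

Lemma binary_expansion_double (m : nat) :
  2 <= m ->
  binary_expansion m = binary_expansion (m / 2) ++ [Nat.odd m].
Proof.
intros hm. unfold binary_expansion.
assert (hl : Nat.log2 m = S (Nat.log2 (m / 2))).
{ rewrite <- Nat.div2_div.
  pose proof (Nat.div2_odd m) as e.
  assert (0 < Nat.div2 m) by (destruct (Nat.odd m); simpl in e; lia).
  rewrite e at 1. destruct (Nat.odd m); simpl Nat.b2n.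
  - apply Nat.log2_succ_double; lia.
  - rewrite Nat.add_0_r. apply Nat.log2_double; lia. }
rewrite hl. set (l := Nat.log2 (m / 2)).
change (seq 0 (S (S l))) with (0 :: seq 1 (S l)).
rewrite <- seq_shift. cbn [rev].
rewrite map_app, <- map_rev, map_map. f_equal.
apply map_ext. intros i. symmetry. apply Nat.div2_bits.
Qed.

Lemma v2_binary_expansion (m : nat) : v2 (binary_expansion m) = m.
Proof.
induction m as [m IH] using lt_wf_ind.
destruct (le_lt_dec 2 m) as [h|h].
- rewrite binary_expansion_double, v2_app, IH by (try apply Nat.div_lt; lia).
  pose proof (Nat.div2_odd m) as e. rewrite Nat.div2_div in e.
  cbn [v2 length Nat.pow]. lia.
- destruct m as [|[|m]]; [reflexivity..|lia].
Qed.

Lemma occurrences_repeat_false (w : word) (m : nat) :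
  v2 w <> 0 -> occurrences w (repeat false m) = 0.
Proof.
intros hw. induction m as [|m IH]; [reflexivity|].
cbn [repeat occurrences]. rewrite IH.
destruct (list_eq_dec bool_dec _ w) as [h|_]; [exfalso|reflexivity].
apply hw. rewrite <- h.
change (false :: repeat false m) with (repeat false (S m)).
generalize (S m). clear. induction (length w) as [|k IH]; intros [|m]; simpl; auto.
Qed.

(* The value 0 at n = 0 makes [N2_half] hold from m = 1 on; [N2 w 0] is junk. *)
Definition N2_from_0 (w : word) (n : nat) : nat :=
  match n with 0 => 0 | _ => N2 w n end.

(** The padded expansion still has value [m], so splitting off its last |w| digits is division by
    2^|w| with remainder; a word is determined by its length and value. *)
Lemma last_block_padded_expansion (w : word) (m : nat) :
  1 <= m ->
  last_block w (repeat false (padding w) ++ binary_expansion m) = w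
  <-> m mod 2 ^ length w = v2 w.
Proof.
intros hm.
set (u := repeat false (padding w) ++ binary_expansion m).
assert (hu : v2 u = m).
{ unfold u. rewrite v2_app, v2_repeat_false, v2_binary_expansion. lia. }
set (p := firstn (length u - length w) u).
assert (hpu : u = p ++ last_block w u) by (symmetry; apply firstn_skipn).
assert (hq : 2 ^ length w <> 0) by (apply Nat.pow_nonzero; lia).
split.
- intros h. rewrite h in hpu. rewrite <- hu, hpu, v2_app.
  rewrite Nat.add_comm, Nat.Div0.mod_add. apply Nat.mod_small, v2_lt.
- intros h. destruct (le_lt_dec (length w) (length u)) as [hl|hl].
  + assert (hs : length (last_block w u) = length w)
      by (unfold last_block; rewrite length_skipn; lia).
    apply v2_inj; [exact hs|].
    rewrite hpu, v2_app, hs in hu.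
    rewrite <- h, <- hu, Nat.add_comm, Nat.Div0.mod_add. symmetry.
    apply Nat.mod_small. rewrite <- hs. apply v2_lt.
  (* With fewer than |w| digits, the congruence forces m = v2 w < 2^(|w|-1), so [w] begins with 0.
     Value 0 contradicts m >= 1, and otherwise the padding alone supplies |w| digits. *)
  + exfalso.
    pose proof (v2_lt u) as hlt. rewrite hu in hlt.
    assert (2 ^ length u <= 2 ^ (length w - 1))
      by (apply Nat.pow_le_mono_r; lia).
    assert (2 ^ (length w - 1) <= 2 ^ length w)
      by (apply Nat.pow_le_mono_r; lia).
    rewrite Nat.mod_small in h by lia.
    destruct w as [|[] w]; simpl in *; [lia| |].
    * rewrite Nat.sub_0_r in *. lia.
    * unfold u, padding in hl. destruct (Nat.eq_dec _ 0) as [e|e].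
      -- simpl in e. lia.
      -- rewrite length_app, repeat_length in hl. simpl in hl. lia.
Qed.

Lemma N2_half (w : word) (m : nat) :
  w <> [] -> 1 <= m ->
  N2_from_0 w m
  = N2_from_0 w (m / 2) + indic (Nat.eq_dec (m mod 2 ^ length w) (v2 w)).
Proof.
intros hw hm.
assert (step : forall u d,
  binary_expansion m = u ++ [d] ->
  N2 w m = occurrences w (repeat false (padding w) ++ u)
           + indic (Nat.eq_dec (m mod 2 ^ length w) (v2 w))).
{ intros u d e. unfold N2.
  rewrite e, app_assoc, occurrences_snoc, <- app_assoc, <- e by assumption.
  f_equal. apply indic_iff, last_block_padded_expansion, hm. }
destruct (le_lt_dec 2 m) as [h|h].
- assert (h2 : 1 <= m / 2) by (apply Nat.div_le_lower_bound; lia).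
  rewrite (binary_expansion_double m h) in step.
  specialize (step _ _ eq_refl).
  destruct m as [|m']; [lia|]. unfold N2_from_0 at 1. rewrite step.
  destruct (S m' / 2); [lia|reflexivity].
(* For m = 1 only the padding precedes the last digit. It contains no occurrence of [w], in
   agreement with the value 0 chosen at n = 0. *)
- replace m with 1 in * by lia. change (1 / 2) with 0.
  unfold N2_from_0. rewrite (step [] true eq_refl), app_nil_r.
  f_equal.
  unfold padding. destruct w as [|[] w]; [reflexivity..|].
  destruct (Nat.eq_dec _ 0); [reflexivity|now apply occurrences_repeat_false].
Qed.

(** Each halving loses at most one occurrence, so the count is logarithmic in [m]; the exponential
    form keeps the argument in [nat]. *)
Lemma N2_growth (w : word) (m : nat) :
  w <> [] -> 1 <= m -> 2 ^ N2_from_0 w m <= 2 * m.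
Proof.
intros hw. induction m as [m IH] using lt_wf_ind. intros hm.
assert (hi : N2_from_0 w m <= N2_from_0 w (m / 2) + 1).
{ rewrite N2_half by assumption.
  unfold indic; destruct (Nat.eq_dec _ _); lia. }
apply (Nat.pow_le_mono_r 2) in hi; [|lia].
rewrite Nat.pow_add_r in hi. simpl (2 ^ 1) in hi.
destruct (le_lt_dec 2 m) as [h|h].
- pose proof (Nat.div_le_lower_bound m 2 1 ltac:(lia) ltac:(lia)).
  pose proof (IH (m / 2) (Nat.div_lt m 2 ltac:(lia) ltac:(lia)) ltac:(lia)).
  pose proof (Nat.div_mod_eq m 2). lia.
- replace m with 1 in * by lia. change (N2_from_0 w (1 / 2)) with 0 in hi.
  simpl in *. lia.
Qed.

(** A bound of order sqrt m is all that [digit_tail_vanishes] asks for. *)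
Lemma N2_square_le (w : word) (m : nat) :
  w <> [] -> 1 <= m -> N2_from_0 w m * N2_from_0 w m <= 4 * m.
Proof.
intros hw hm. pose proof (N2_growth w m hw hm) as h.
(* The second conjunct bounds the increment 2n + 1 of the square and so carries the induction for
   the first. *)
assert (hn : forall n, n * n <= 2 * 2 ^ n /\ 2 * n + 1 <= 2 * 2 ^ n).
{ induction n as [|n [IH1 IH2]]; [simpl; lia|]. rewrite Nat.pow_succ_r'.
  destruct n as [|[|n]]; [simpl in *; lia..|]. simpl Nat.add in *. lia. }
destruct (hn (N2_from_0 w m)). lia.
Qed.

Local Open Scope R_scope.

(** * Euler's integral *)

Lemma exp_le_compat (a b : R) : a <= b -> exp a <= exp b.
Proof.
intros [h | ->]; [apply Rlt_le, exp_increasing, h | apply Rle_refl].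
Qed.

(** The tangent of ln at 1, from which the later bounds on logarithms are drawn by a suitable choice
    of [u]. *)
Lemma ln_le_pred (u : R) : 0 < u -> ln u <= u - 1.
Proof.
intros hu. pose proof (exp_ineq1_le (ln u)) as h.
rewrite exp_ln in h by assumption. lra.
Qed.

Lemma ball_R (x y : R) (e : posreal) : ball x e y -> x - e < y < x + e.
Proof.
unfold ball; simpl; unfold AbsRing_ball, abs, minus, plus, opp; simpl.
intros h. apply Rabs_def2 in h. lra.
Qed.

(** * Convergence and positivity of Euler's integral *)

Definition gamma_integrand (x t : R) : R := Rpower t (x - 1) * exp (- t).

Lemma Rpower_pred (t y : R) : 0 < t -> Rpower t (y - 1) = exp (y * ln t) / t.
Proof.
intros ht. unfold Rpower. rewrite <- (exp_ln t) at 3 by assumption.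
unfold Rdiv. rewrite <- exp_Ropp, <- exp_plus. f_equal; ring.
Qed.

Lemma gamma_integrand_pos (x t : R) : 0 < gamma_integrand x t.
Proof. apply Rmult_lt_0_compat; apply exp_pos. Qed.

Lemma gamma_integrand_continuous (x t : R) :
  0 < t -> continuous (gamma_integrand x) t.
Proof.
intros ht. apply (ex_derive_continuous (gamma_integrand x)).
unfold gamma_integrand, Rpower. auto_derive. assumption.
Qed.

(** The improper integral is a limit over pairs of endpoints; this reduces a side condition along
    that filter to genuine intervals, using a < 1 < b. *)
Lemma interval_eventually (P : R * R -> Prop) :
  (forall a b, 0 < a -> a < b -> P (a, b)) ->
  filter_prod (at_right 0) (Rbar_locally p_infty) P.
Proof.
intros h.
apply (Filter_prod _ _ _ (fun a => 0 < a < 1) (fun b => 1 < b)).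
- exists (mkposreal 1 Rlt_0_1). intros y hy h0.
  apply ball_R in hy; simpl in hy. lra.
- exists 1. auto.
- intros a b ha hb. apply h; lra.
Qed.

(** For a nonnegative integrand the integral grows with the interval, so the limit is the supremum
    over compact intervals. An interval within [eps] of the supremum controls every larger one. *)
Lemma nonneg_ex_RInt_gen (f : R -> R) (M : R) :
  (forall t, 0 < t -> 0 <= f t) ->
  (forall t, 0 < t -> continuous f t) ->
  (forall a b, 0 < a -> a < b -> RInt f a b <= M) ->
  ex_RInt_gen f (at_right 0) (Rbar_locally p_infty).
Proof.
intros hpos hcont hM.
assert (hex : forall a b, 0 < a -> 0 < b -> ex_RInt f a b).
{ intros a b ha hb. apply (ex_RInt_continuous f). intros z hz. apply hcont.
  pose proof (Rmin_glb_lt a b 0 ha hb). lra. }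
set (E := fun y => exists a b, 0 < a /\ a < b /\ y = RInt f a b).
destruct (completeness E) as [l [hub hlub]].
{ exists M. intros y (a & b & ha & hb & ->). auto. }
{ exists (RInt f 1 2), 1, 2. repeat split; lra. }
exists l. intros P [eps hP].
destruct (classic (exists a b, 0 < a /\ a < b /\ l - eps < RInt f a b))
  as [(a0 & b0 & ha0 & hb0 & hl) | hno].
2: { exfalso. assert (l <= l - eps).
  { apply hlub. intros y (a & b & ha & hb & ->).
    apply Rnot_lt_le. intros hlt. apply hno. exists a, b. auto. }
  pose proof (cond_pos eps). lra. }
apply (Filter_prod _ _ _ (fun a => 0 < a < a0) (fun b => b0 < b)).
- exists (mkposreal a0 ha0). intros y hy h0.
  apply ball_R in hy; simpl in hy. lra.
- exists b0. auto.
- intros a b ha hb. exists (RInt f a b). split.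
  { apply (RInt_correct f), hex; simpl; lra. }
  apply hP.
  assert (hle : RInt f a0 b0 <= RInt f a b).
  { rewrite <- (RInt_Chasles f a a0 b) by (apply hex; lra).
    rewrite <- (RInt_Chasles f a0 b0 b) by (apply hex; lra).
    assert (0 <= RInt f a a0) by
      (apply RInt_ge_0; [lra|apply hex; lra|intros; apply hpos; lra]).
    assert (0 <= RInt f b0 b) by
      (apply RInt_ge_0; [lra|apply hex; lra|intros; apply hpos; lra]).
    unfold plus; simpl. lra. }
  assert (RInt f a b <= l) by (apply hub; exists a, b; repeat split; lra).
  unfold ball; simpl; unfold AbsRing_ball, abs, minus, plus, opp; simpl.
  apply Rabs_def1; lra.
Qed.

(** This is [ln_le_pred] at (1 + t)/c, multiplied by [c] and weakened by dropping a term -c from the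
    exponent. *)
Lemma exp_dominates_power (c : R) :
  0 < c ->
  forall t, 0 < t -> exp (- t) <= exp (1 + c * ln c) * exp (- c * ln (1 + t)).
Proof.
intros hc t ht. rewrite <- exp_plus. apply exp_le_compat.
pose proof (ln_le_pred ((1 + t) / c) ltac:(apply Rdiv_lt_0_compat; lra)) as h.
rewrite ln_div in h by lra.
apply (Rmult_le_compat_l c) in h; [|lra].
replace (c * ((1 + t) / c - 1)) with (1 + t - c) in h by (field; lra).
lra.
Qed.

(** Decay of order x + 1 is chosen so that the majorant has an elementary antiderivative on the
    whole half-line; no splitting at 1 is required. *)
Lemma gamma_integrand_RInt_bound (x a b : R) :
  0 < x -> 0 < a -> a < b ->
  RInt (gamma_integrand x) a b <= exp (1 + (x + 1) * ln (x + 1)) / x.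
Proof.
intros hx ha hb. set (C := exp (1 + (x + 1) * ln (x + 1))).
(* [(t / (1 + t))^x / x] is a bounded antiderivative of [t^(x-1) / (1 + t)^(x+1)] *)
set (H := fun t => exp (x * (ln t - ln (1 + t))) / x).
set (dH := fun t => exp (x * (ln t - ln (1 + t))) / (t * (1 + t))).
assert (hH : is_RInt (fun t => scal C (dH t)) a b (scal C (minus (H b) (H a)))).
{ apply (is_RInt_scal dH). apply (is_RInt_derive H dH).
  - intros t ht. rewrite Rmin_left in ht by lra.
    unfold H, dH. auto_derive; [lra|]. unfold Rminus. field; lra.
  - intros t ht. rewrite Rmin_left in ht by lra.
    apply (ex_derive_continuous dH). unfold dH. auto_derive.
    repeat split; try lra. nra. }
apply Rle_trans with (RInt (fun t => scal C (dH t)) a b).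
- apply RInt_le; [lra| |eexists; exact hH|].
  + apply (ex_RInt_continuous (gamma_integrand x)). intros t ht.
    rewrite Rmin_left in ht by lra. apply gamma_integrand_continuous; lra.
  + intros t ht. unfold gamma_integrand. rewrite Rpower_pred by lra.
    pose proof (exp_dominates_power (x + 1) ltac:(lra) t ltac:(lra)) as h.
    fold C in h. unfold scal; simpl; unfold mult; simpl. unfold dH.
    replace (- (x + 1) * ln (1 + t)) with (- (x * ln (1 + t)) + - ln (1 + t)) in h
      by ring.
    rewrite exp_plus, (exp_Ropp (ln (1 + t))), exp_ln in h by lra.
    replace (x * (ln t - ln (1 + t))) with (x * ln t + - (x * ln (1 + t))) by ring.
    rewrite exp_plus.
    replace (C * (exp (x * ln t) * exp (- (x * ln (1 + t))) / (t * (1 + t))))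
      with (exp (x * ln t) / t * (C * (exp (- (x * ln (1 + t))) * / (1 + t))))
      by (field; lra).
    apply Rmult_le_compat_l; [|exact h].
    apply Rlt_le, Rdiv_lt_0_compat; [apply exp_pos|lra].
- rewrite (is_RInt_unique _ _ _ _ hH).
  unfold scal; simpl; unfold mult, minus, plus, opp; simpl.
  unfold Rdiv at 1. apply Rmult_le_compat_l; [apply Rlt_le, exp_pos|].
  assert (0 < H a) by (apply Rdiv_lt_0_compat; [apply exp_pos|lra]).
  assert (H b <= / x); [|lra].
  unfold H, Rdiv. rewrite <- (Rmult_1_l (/ x)) at 2.
  apply Rmult_le_compat_r; [apply Rlt_le, Rinv_0_lt_compat; lra|].
  apply Rle_trans with (exp 0); [|rewrite exp_0; lra]. apply exp_le_compat.
  assert (ln b <= ln (1 + b)) by (apply ln_le; lra).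
  assert (0 <= x * (ln (1 + b) - ln b)) by (apply Rmult_le_pos; lra). lra.
Qed.

Lemma Gamma_correct (x : R) :
  0 < x ->
  is_RInt_gen (gamma_integrand x) (at_right 0) (Rbar_locally p_infty) (Gamma x).
Proof.
intros hx. apply (RInt_gen_correct (gamma_integrand x)).
apply (nonneg_ex_RInt_gen _ (exp (1 + (x + 1) * ln (x + 1)) / x)).
- intros t _. apply Rlt_le, gamma_integrand_pos.
- apply gamma_integrand_continuous.
- intros. now apply gamma_integrand_RInt_bound.
Qed.

(** The integral over [1, 2] is a positive lower bound for the integrals over larger intervals,
    which therefore cannot approach a limit <= 0. *)
Lemma Gamma_pos (x : R) : 0 < x -> 0 < Gamma x.
Proof.
intros hx. pose proof (Gamma_correct x hx) as hG.
assert (hex : forall a b, 0 < a -> 0 < b -> ex_RInt (gamma_integrand x) a b).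
{ intros a b ha hb. apply (ex_RInt_continuous (gamma_integrand x)). intros z hz.
  apply gamma_integrand_continuous.
  pose proof (Rmin_glb_lt a b 0 ha hb). lra. }
set (c := RInt (gamma_integrand x) 1 2).
assert (hc : 0 < c).
{ apply RInt_gt_0; [lra|intros; apply gamma_integrand_pos|].
  intros; apply gamma_integrand_continuous; lra. }
assert (hpos : forall t, 0 <= gamma_integrand x t)
  by (intros; apply Rlt_le, gamma_integrand_pos).
apply Rnot_le_lt. intros hle.
assert (hn : locally (Gamma x) (fun y => y < c)).
{ apply (open_lt c (Gamma x)). lra. }
specialize (hG _ hn). destruct hG as [Q S hQ hS h].
assert (hQ' : at_right 0 (fun a => Q a /\ 0 < a < 1)).
{ apply filter_and; [exact hQ|]. exists (mkposreal 1 Rlt_0_1). intros y hy h0.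
  apply ball_R in hy; simpl in hy. lra. }
assert (hS' : Rbar_locally p_infty (fun b => S b /\ 2 < b)).
{ apply filter_and; [exact hS|]. exists 2. auto. }
destruct (filter_ex _ hQ') as [a [qa ha]].
destruct (filter_ex _ hS') as [b [sb hb]].
destruct (h a b qa sb) as [y [hy hyc]]. simpl in hy.
rewrite <- (is_RInt_unique _ _ _ _ hy) in hyc.
rewrite <- (RInt_Chasles _ a 1 b) in hyc by (apply hex; lra).
rewrite <- (RInt_Chasles _ 1 2 b) in hyc by (apply hex; lra).
assert (0 <= RInt (gamma_integrand x) a 1) by
  (apply RInt_ge_0; [lra|apply hex; lra|intros; apply hpos]).
assert (0 <= RInt (gamma_integrand x) 2 b) by
  (apply RInt_ge_0; [lra|apply hex; lra|intros; apply hpos]).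
unfold plus in hyc; simpl in hyc. fold c in hyc. lra.
Qed.

(** * Antiderivatives on the half-line and the functional equation *)

Lemma is_RInt_gen_pos_derive (F f : R -> R) (la lb : R) :
  (forall t, 0 < t -> is_derive F t (f t)) ->
  (forall t, 0 < t -> continuous f t) ->
  filterlim F (at_right 0) (locally la) ->
  filterlim F (Rbar_locally p_infty) (locally lb) ->
  is_RInt_gen f (at_right 0) (Rbar_locally p_infty) (lb - la).
Proof.
intros hF hf ha hb.
assert (hD : forall t, 0 < t -> Derive F t = f t)
  by (intros; apply is_derive_unique; auto).
apply (is_RInt_gen_ext (Derive F)).
{ apply interval_eventually. intros a b pa hab t ht. simpl in ht.
  rewrite Rmin_left in ht by lra. apply hD; lra. }
apply is_RInt_gen_Derive; [| |assumption|assumption];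
  apply interval_eventually; intros a b pa hab t ht; simpl in ht;
  rewrite Rmin_left in ht by lra.
- exists (f t). apply hF; lra.
- apply (continuous_ext_loc _ f); [|apply hf; lra].
  (* Radius [t] keeps the neighbourhood inside the positive reals. *)
  exists (mkposreal t ltac:(lra)). intros y hy. symmetry. apply hD.
  apply ball_R in hy; simpl in hy. lra.
Qed.

Lemma is_RInt_gen_pos_inj (f : R -> R) (l l' : R) :
  is_RInt_gen f (at_right 0) (Rbar_locally p_infty) l ->
  is_RInt_gen f (at_right 0) (Rbar_locally p_infty) l' -> l = l'.
Proof.
intros h h'. rewrite <- (is_RInt_gen_unique (V := R_CompleteNormedModule) f l h).
apply (is_RInt_gen_unique (V := R_CompleteNormedModule) f l' h').
Qed.

Lemma power_exp_lim_0 (x : R) :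
  0 < x ->
  filterlim (fun t => Rpower t x * exp (- t)) (at_right 0) (locally 0).
Proof.
intros hx P [eps hP].
(* For t < eps^(1/x) one has t^x < eps, and the exponential factor is at most 1. *)
set (d := Rpower eps (/ x)).
assert (hd : 0 < d) by apply exp_pos.
exists (mkposreal d hd). intros t ht h0.
apply ball_R in ht; simpl in ht.
apply hP. unfold ball; simpl; unfold AbsRing_ball, abs, minus, plus, opp; simpl.
assert (hp : Rpower t x < eps).
{ pose proof (cond_pos eps) as he.
  replace (pos eps) with (Rpower d x).
  - apply Rlt_Rpower_l; lra.
  - unfold d. rewrite Rpower_mult, Rinv_l, Rpower_1 by lra. reflexivity. }
assert (0 < Rpower t x) by apply exp_pos.
assert (exp (- t) <= 1).
{ apply Rle_trans with (exp 0); [apply exp_le_compat; lra | rewrite exp_0; lra]. }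
pose proof (exp_pos (- t)).
apply Rabs_def1; nra.
Qed.

(** Taking decay of order x + 1 leaves a spare factor: t^x e^(-t) <= C/(1 + t), which is below [eps]
    once t > C/eps. *)
Lemma power_exp_lim_infty (x : R) :
  0 <= x ->
  filterlim (fun t => Rpower t x * exp (- t)) (Rbar_locally p_infty) (locally 0).
Proof.
intros hx. set (C := exp (1 + (x + 1) * ln (x + 1))).
assert (hC : 0 < C) by apply exp_pos.
intros P [eps hP]. exists (C / eps). intros t ht.
pose proof (cond_pos eps) as he.
assert (0 < t) by (apply Rlt_trans with (C / eps); [apply Rdiv_lt_0_compat|]; lra).
apply hP. unfold ball; simpl; unfold AbsRing_ball, abs, minus, plus, opp; simpl.
pose proof (exp_dominates_power (x + 1) ltac:(lra) t ltac:(lra)) as h.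
fold C in h.
replace (- (x + 1) * ln (1 + t)) with (- (x * ln (1 + t)) + - ln (1 + t)) in h
  by ring.
rewrite exp_plus, (exp_Ropp (ln (1 + t))), exp_ln in h by lra.
assert (hp : Rpower t x <= Rpower (1 + t) x) by (apply Rle_Rpower_l; lra).
assert (e : exp (- (x * ln (1 + t))) * Rpower (1 + t) x = 1).
{ unfold Rpower. rewrite <- exp_plus, Rplus_opp_l. apply exp_0. }
assert (0 < Rpower t x) by apply exp_pos.
assert (0 < Rpower (1 + t) x) by apply exp_pos.
pose proof (exp_pos (- t)).
assert (Rpower t x * exp (- t) <= C * / (1 + t)).
{ apply Rle_trans with (Rpower (1 + t) x * exp (- t)).
  - apply Rmult_le_compat_r; lra.
  - apply Rle_trans with
      (Rpower (1 + t) x * (C * (exp (- (x * ln (1 + t))) * / (1 + t)))).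
    + apply Rmult_le_compat_l; lra.
    + replace (Rpower (1 + t) x * (C * (exp (- (x * ln (1 + t))) * / (1 + t))))
        with (exp (- (x * ln (1 + t))) * Rpower (1 + t) x * (C * / (1 + t)))
        by ring.
      rewrite e. lra. }
assert (C * / (1 + t) < eps).
{ apply (Rmult_lt_reg_r (1 + t)); [lra|].
  rewrite Rmult_assoc, Rinv_l, Rmult_1_r by lra.
  apply (Rmult_lt_compat_r eps) in ht; [|lra].
  unfold Rdiv in ht. rewrite Rmult_assoc, Rinv_l, Rmult_1_r in ht by lra. nra. }
assert (0 < Rpower t x * exp (- t)) by (apply Rmult_lt_0_compat; lra).
apply Rabs_def1; lra.
Qed.

(** Integration by parts: -t^x e^(-t) has derivative t^x e^(-t) - x t^(x-1) e^(-t) and vanishes at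
    both ends. *)
Lemma Gamma_succ (x : R) : 0 < x -> Gamma (x + 1) = x * Gamma x.
Proof.
intros hx.
pose (F := fun t => - (Rpower t x * exp (- t))).
assert (h : is_RInt_gen
  (fun t => minus (gamma_integrand (x + 1) t) (scal x (gamma_integrand x t)))
  (at_right 0) (Rbar_locally p_infty) (- 0 - - 0)).
{ apply (is_RInt_gen_pos_derive F).
  - intros t ht. unfold F, gamma_integrand.
    rewrite (Rpower_pred t x ht).
    unfold minus, scal, plus, opp; simpl; unfold mult; simpl.
    unfold Rpower. auto_derive; [assumption|].
    replace (x + 1 - 1) with x by ring. field. lra.
  - intros t ht. apply (continuous_minus (gamma_integrand (x + 1))).
    + now apply gamma_integrand_continuous.
    + apply (continuous_scal_r x (gamma_integrand x)).
      now apply gamma_integrand_continuous.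
  - apply (filterlim_comp _ _ _ _ Ropp _ (locally 0)).
    + now apply power_exp_lim_0.
    + apply (filterlim_opp 0).
  - apply (filterlim_comp _ _ _ _ Ropp _ (locally 0)).
    + apply power_exp_lim_infty; lra.
    + apply (filterlim_opp 0). }
pose proof (is_RInt_gen_minus (Fa := at_right 0)
  (Fb := Rbar_locally p_infty) _ _ _ _
  (Gamma_correct (x + 1) ltac:(lra))
  (is_RInt_gen_scal _ x _ (Gamma_correct x hx))) as h'.
pose proof (is_RInt_gen_pos_inj _ _ _ h h') as e. revert e.
unfold minus, scal, plus, opp; simpl; unfold mult; simpl.
lra.
Qed.

Lemma Gamma_1 : Gamma 1 = 1.
Proof.
assert (h : is_RInt_gen (gamma_integrand 1)
  (at_right 0) (Rbar_locally p_infty) (- 0 - - 1)).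
{ apply (is_RInt_gen_pos_derive (fun t => - exp (- t))).
  - intros t ht. unfold gamma_integrand. rewrite Rminus_diag, Rpower_O by assumption.
    auto_derive; [trivial|ring].
  - apply gamma_integrand_continuous.
  - apply (filterlim_filter_le_1 (F := locally 0)).
    { intros P [e he]. exists e. intros; auto. }
    replace (-1) with (- exp (- 0)) by (rewrite Ropp_0, exp_0; reflexivity).
    apply (ex_derive_continuous (fun t => - exp (- t))). auto_derive. trivial.
  - apply (filterlim_comp _ _ _ (fun t => exp (- t)) Ropp _ (locally 0)).
    + apply (filterlim_ext_loc (fun t => Rpower t 0 * exp (- t))).
      * exists 0. intros t ht. rewrite Rpower_O by assumption. ring.
      * apply power_exp_lim_infty; lra.
    + apply (filterlim_opp 0). }
pose proof (Gamma_correct 1 Rlt_0_1) as h'.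
pose proof (is_RInt_gen_pos_inj _ _ _ h h'). lra.
Qed.

(* Weighted AM-GM: ln is concave at c = 1 - s + s u. *)
Lemma power_le_tangent (s u : R) :
  0 <= s <= 1 -> 0 < u -> exp (s * ln u) <= 1 - s + s * u.
Proof.
intros hs hu. set (c := 1 - s + s * u).
assert (hc : 0 < c) by (unfold c; destruct (Req_dec s 0) as [->|]; [lra|nra]).
rewrite <- (exp_ln c) by assumption. apply exp_le_compat.
(* Tangent inequalities at [c] for the points u and 1. With weights s and 1 - s their right-hand
   sides cancel, since [c] is the weighted mean. *)
pose proof (ln_le_pred (u / c) ltac:(apply Rdiv_lt_0_compat; lra)) as h1.
pose proof (ln_le_pred (1 / c) ltac:(apply Rdiv_lt_0_compat; lra)) as h2.
rewrite ln_div in h1, h2 by lra. rewrite ln_1 in h2.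
apply (Rmult_le_compat_l s) in h1; [|lra].
apply (Rmult_le_compat_l (1 - s)) in h2; [|lra].
assert (e : s * (u / c - 1) + (1 - s) * (1 / c - 1) = 0).
{ replace (s * (u / c - 1) + (1 - s) * (1 / c - 1)) with (c / c - 1)
    by (unfold c at 1; field; lra). field. lra. }
lra.
Qed.

(* Wendel's inequality *)
Lemma Gamma_shift_le (x s : R) :
  0 < x -> 0 <= s <= 1 -> Gamma (x + s) <= Rpower x s * Gamma x.
Proof.
intros hx hs.
set (c := Rpower x s).
assert (hc : 0 < c) by apply exp_pos.
assert (h : is_RInt_gen
  (fun t => plus (scal (c * (1 - s)) (gamma_integrand x t))
                 (scal (c * s / x) (gamma_integrand (x + 1) t)))
  (at_right 0) (Rbar_locally p_infty)
  (plus (scal (c * (1 - s)) (Gamma x)) (scal (c * s / x) (Gamma (x + 1))))).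
{ apply (is_RInt_gen_plus (fun t => scal (c * (1 - s)) (gamma_integrand x t)));
    apply (is_RInt_gen_scal (gamma_integrand _)); apply Gamma_correct; lra. }
pose proof (Gamma_correct (x + s) ltac:(lra)) as hG.
assert (hle : norm (Gamma (x + s)) <=
  plus (scal (c * (1 - s)) (Gamma x)) (scal (c * s / x) (Gamma (x + 1)))).
{ refine (RInt_gen_norm (V := R_CompleteNormedModule) (Fa := at_right 0)
    (Fb := Rbar_locally p_infty) _ _ _ _ _ _ hG h);
    apply interval_eventually; intros a b ha hab; simpl.
  - lra.
  - intros t ht. unfold norm; simpl; unfold abs; simpl.
    rewrite Rabs_pos_eq by apply Rlt_le, gamma_integrand_pos.
    unfold scal, plus; simpl; unfold mult; simpl.
    unfold gamma_integrand. rewrite !Rpower_pred by lra.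
    (* Factors t^(x+s) as t^x x^s (t/x)^s, so that [power_le_tangent] applies at u = t/x. *)
    replace ((x + s) * ln t) with (x * ln t + s * ln x + s * ln (t / x))
      by (rewrite ln_div by lra; ring).
    replace ((x + 1) * ln t) with (x * ln t + ln t) by ring.
    rewrite !exp_plus, exp_ln by lra.
    fold (Rpower x s). fold c.
    pose proof (power_le_tangent s (t / x) hs
      ltac:(apply Rdiv_lt_0_compat; lra)) as hb.
    set (E := exp (x * ln t) / t * c * exp (- t)).
    assert (0 < E).
    { unfold E, Rdiv. repeat apply Rmult_lt_0_compat;
        try apply exp_pos; try assumption. apply Rinv_0_lt_compat; lra. }
    apply (Rmult_le_compat_l E) in hb; [|lra].
    eapply Rle_trans; [|eapply Rle_trans; [exact hb|]];
      apply Req_le; unfold E; field; lra. }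
unfold norm in hle; simpl in hle; unfold abs in hle; simpl in hle.
rewrite Rabs_pos_eq in hle by (apply Rlt_le, Gamma_pos; lra).
rewrite Gamma_succ in hle by assumption.
unfold scal, plus in hle; simpl in hle; unfold mult in hle; simpl in hle.
replace (c * (1 - s) * Gamma x + c * s / x * (x * Gamma x)) with (c * Gamma x)
  in hle by (field; lra).
exact hle.
Qed.

(** * Partial sums and the logarithmic derivative of Gamma *)

(* Unlike Coquelicot's [sum_n], the last index is excluded. *)
Fixpoint psum (a : nat -> R) (n : nat) : R :=
  match n with
  | O => 0
  | S n' => psum a n' + a n'
  end.

Lemma sum_n_psum (a : nat -> R) (n : nat) : sum_n a n = psum a (S n).
Proof.
induction n as [|n IH].
- rewrite sum_O. simpl. ring.
- rewrite sum_Sn, IH. reflexivity.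
Qed.

Lemma is_series_psum (a : nat -> R) (l : R) :
  is_lim_seq (psum a) l -> is_series a l.
Proof.
intros h. apply is_lim_seq_incr_1 in h.
apply (is_lim_seq_ext _ (sum_n a)) in h; [exact h|].
intros n. now rewrite sum_n_psum.
Qed.

Lemma psum_ext (a b : nat -> R) (n : nat) :
  (forall k, a k = b k) -> psum a n = psum b n.
Proof. intros h. induction n; simpl; congruence. Qed.

Lemma psum_incr (a : nat -> R) (m n : nat) :
  (forall k, 0 <= a k) -> (m <= n)%nat -> psum a m <= psum a n.
Proof.
intros ha hmn. induction hmn as [|n hmn IH]; [lra|].
simpl. pose proof (ha n). lra.
Qed.

Lemma psum_block_le (a : nat -> R) (B : R) (M p : nat) :
  (forall k, (M <= k < M + p)%nat -> a k <= B) ->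
  psum a (M + p) - psum a M <= INR p * B.
Proof.
induction p as [|p IH]; intros h.
- rewrite Nat.add_0_r. simpl. lra.
- rewrite Nat.add_succ_r, S_INR. simpl.
  pose proof (IH ltac:(intros; apply h; lia)).
  pose proof (h (M + p)%nat ltac:(lia)). lra.
Qed.

(** At u = 1/m this is the function g(m) of the summation by parts; at u = h/(x+j) it is the general
    term of the series for an increment of ln Gamma. *)
Definition ln_defect (u : R) : R := u - ln (1 + u).

Lemma ln_defect_nonneg (u : R) : -1 < u -> 0 <= ln_defect u.
Proof.
intros hu. unfold ln_defect. pose proof (ln_le_pred (1 + u) ltac:(lra)). lra.
Qed.

(** [ln_le_pred] at the reciprocal 1/(1 + u) bounds ln (1 + u) from below; the defect is thus of
    second order. *)
Lemma ln_defect_le (u : R) : -1 < u -> ln_defect u <= u * u / (1 + u).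
Proof.
intros hu. unfold ln_defect.
pose proof (ln_le_pred (1 / (1 + u)) ltac:(apply Rdiv_lt_0_compat; lra)) as h.
rewrite ln_div, ln_1 in h by lra.
replace (u * u / (1 + u)) with (u + (1 / (1 + u) - 1)) by (field; lra).
lra.
Qed.

(** * Growth of ln Gamma under bounded shifts *)

Definition lnGamma (x : R) : R := ln (Gamma x).

Lemma lnGamma_succ (x : R) : 0 < x -> lnGamma (x + 1) = lnGamma x + ln x.
Proof.
intros hx. unfold lnGamma. rewrite Gamma_succ, ln_mult by auto using Gamma_pos.
ring.
Qed.

Lemma lnGamma_shift_le (x s : R) :
  0 < x -> 0 <= s <= 1 -> lnGamma (x + s) <= lnGamma x + s * ln x.
Proof.
intros hx hs. unfold lnGamma.
replace (s * ln x) with (ln (Rpower x s)) by apply ln_exp.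
rewrite <- ln_mult by (try apply exp_pos; auto using Gamma_pos).
rewrite (Rmult_comm (Gamma x)).
apply ln_le; [apply Gamma_pos; lra|]. now apply Gamma_shift_le.
Qed.

Definition shift_error (y h : R) : R := lnGamma (y + h) - lnGamma y - h * ln y.

Lemma ln_increment_le (y s : R) : 0 < y -> 0 <= s -> ln (y + s) - ln y <= s / y.
Proof.
intros hy hs. rewrite <- ln_div by lra.
pose proof (ln_le_pred ((y + s) / y) ltac:(apply Rdiv_lt_0_compat; lra)) as h.
replace ((y + s) / y - 1) with (s / y) in h by (field; lra). exact h.
Qed.

(** The upper bound is Wendel's inequality from y. The lower one applies it from y + s with shift 1
    - s, landing at y + 1, where the functional equation returns to y; the loss is (1 - s)(ln (y+s)
    - ln y). *)
Lemma shift_error_nonneg_bound (y s : R) :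
  0 < y -> 0 <= s <= 1 -> - / y <= shift_error y s <= 0.
Proof.
intros hy hs. unfold shift_error.
pose proof (lnGamma_shift_le y s hy hs) as h1.
pose proof (lnGamma_shift_le (y + s) (1 - s) ltac:(lra) ltac:(lra)) as h2.
replace (y + s + (1 - s)) with (y + 1) in h2 by ring.
rewrite lnGamma_succ in h2 by assumption.
pose proof (ln_increment_le y s hy ltac:(lra)) as h3.
apply (Rmult_le_compat_l (1 - s)) in h3; [|lra].
assert (hi : 0 < / y) by now apply Rinv_0_lt_compat.
assert ((1 - s) * (s / y) <= / y).
{ unfold Rdiv. rewrite <- Rmult_assoc. rewrite <- (Rmult_1_l (/ y)) at 2.
  apply Rmult_le_compat_r; nra. }
lra.
Qed.

(** Negative shifts serve the two-sided derivative of [lnGamma]. For -1 < h < 0 the shift is read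
    backwards from y + h, at the cost of exchanging ln (y+h) for ln y; h = -1 is the functional
    equation. *)
Lemma shift_error_bound (y h : R) :
  1 < y -> -1 <= h <= 1 -> Rabs (shift_error y h) <= 2 / (y - 1).
Proof.
intros hy hh.
assert (hi : 0 < / (y - 1)) by (apply Rinv_0_lt_compat; lra).
apply Rabs_le. unfold Rdiv.
destruct (Rle_lt_dec 0 h) as [h0|h0].
- pose proof (shift_error_nonneg_bound y h ltac:(lra) ltac:(lra)).
  assert (/ y <= / (y - 1)) by (apply Rinv_le_contravar; lra).
  lra.
- destruct (Req_dec h (-1)) as [e|e].
  + subst h. unfold shift_error. pose proof (lnGamma_succ (y - 1) ltac:(lra)) as e.
    replace (y - 1 + 1) with y in e by ring.
    replace (y + -1) with (y - 1) by ring. rewrite e.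
    pose proof (ln_increment_le (y - 1) 1 ltac:(lra) ltac:(lra)) as h3.
    replace (y - 1 + 1) with y in h3 by ring.
    assert (ln (y - 1) <= ln y) by (apply ln_le; lra). lra.
  + pose proof (shift_error_nonneg_bound (y + h) (- h) ltac:(lra) ltac:(lra)) as h1.
    unfold shift_error in *. replace (y + h + - h) with y in h1 by ring.
    pose proof (ln_increment_le (y + h) (- h) ltac:(lra) ltac:(lra)) as h3.
    replace (y + h + - h) with y in h3 by ring.
    assert (ln (y + h) <= ln y) by (apply ln_le; lra).
    assert (hle : / (y + h) <= / (y - 1)) by (apply Rinv_le_contravar; lra).
    assert (h4 : - h * (ln y - ln (y + h)) <= / (y - 1)).
    { assert (0 < / (y + h)) by (apply Rinv_0_lt_compat; lra).
      unfold Rdiv in h3. nra. }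
    assert (0 <= - h * (ln y - ln (y + h))) by (apply Rmult_le_pos; lra).
    lra.
Qed.

(** * The digamma limit as logarithmic derivative of Gamma *)

Definition digamma_seq (x : R) (n : nat) : R :=
  ln (x + INR n) - psum (fun j => / (x + INR j)) n.

Definition digamma (x : R) : R := real (Lim_seq (digamma_seq x)).

(** The sequence decreases by [ln_defect] of 1/(x+n) at each step. That is at most 1/(x+n) -
    1/(x+n+1), and the telescoping sum of these gives the lower bound ln x - 1/x. *)
Lemma digamma_correct (x : R) :
  0 < x -> is_lim_seq (digamma_seq x) (digamma x).
Proof.
intros hx.
assert (hp : forall n, 0 < x + INR n) by (intros n; pose proof (pos_INR n); lra).
assert (step : forall n, digamma_seq x (S n) - digamma_seq x n
                         = - ln_defect (/ (x + INR n))).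
{ intros n. pose proof (hp n). unfold digamma_seq, ln_defect. rewrite S_INR. simpl.
  replace (x + (INR n + 1)) with ((x + INR n) * (1 + / (x + INR n)))
    by (field; lra).
  assert (0 < / (x + INR n)) by (apply Rinv_0_lt_compat; lra).
  rewrite ln_mult by lra. ring. }
assert (hex : ex_finite_lim_seq (digamma_seq x)).
{ apply (ex_finite_lim_seq_decr _ (ln x - / x)).
  - intros n. pose proof (step n).
    assert (0 < / (x + INR n)) by (apply Rinv_0_lt_compat, hp).
    pose proof (ln_defect_nonneg (/ (x + INR n)) ltac:(lra)). lra.
  - intros n.
    assert (h : ln x - / x <= digamma_seq x n - / (x + INR n)).
    { induction n as [|n IH].
      - unfold digamma_seq. simpl. rewrite Rplus_0_r. lra.
      - pose proof (step n). pose proof (hp n). pose proof (hp (S n)) as hS.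
        assert (0 < / (x + INR n)) by (apply Rinv_0_lt_compat, hp).
        pose proof (ln_defect_le (/ (x + INR n)) ltac:(lra)) as hd.
        rewrite S_INR in *.
        replace (/ (x + INR n) * / (x + INR n) / (1 + / (x + INR n)))
          with (/ (x + INR n) - / (x + (INR n + 1))) in hd by (field; lra).
        lra. }
    assert (0 < / (x + INR n)) by (apply Rinv_0_lt_compat, hp). lra. }
apply Lim_seq_correct' in hex. exact hex.
Qed.

(** By the functional equation at x + n and x + n + h the logarithms telescope; the terms h ln (x+n)
    in [digamma_seq] and [shift_error] cancel. *)
Lemma psum_ln_defect (x h : R) (n : nat) :
  0 < x -> 0 < x + h ->
  psum (fun j => ln_defect (h / (x + INR j))) n
  = lnGamma (x + h) - lnGamma x - h * digamma_seq x n
    - shift_error (x + INR n) h.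
Proof.
intros hx hxh. induction n as [|n IH].
- unfold shift_error, digamma_seq. simpl. rewrite !Rplus_0_r. ring.
- simpl psum. rewrite IH. unfold shift_error, digamma_seq, ln_defect.
  pose proof (pos_INR n). rewrite S_INR. simpl psum.
  replace (x + (INR n + 1)) with (x + INR n + 1) by ring.
  replace (x + INR n + 1 + h) with (x + INR n + h + 1) by ring.
  rewrite !lnGamma_succ by lra.
  replace (1 + h / (x + INR n)) with ((x + INR n + h) / (x + INR n)) by (field; lra).
  rewrite ln_div by lra. unfold Rdiv. ring.
Qed.

Lemma is_lim_seq_const_over (c x : R) :
  is_lim_seq (fun n => c / (x + INR n)) 0.
Proof.
replace (Finite 0) with (Rbar_mult c 0) by (simpl; f_equal; ring).
apply (is_lim_seq_scal_l (fun n => / (x + INR n)) c 0).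
replace (Finite 0) with (Rbar_inv p_infty) by reflexivity.
apply is_lim_seq_inv; [|discriminate].
apply (is_lim_seq_plus _ _ x p_infty).
- apply is_lim_seq_const.
- apply is_lim_seq_INR.
- reflexivity.
Qed.

Lemma ln_defect_sum (x h : R) :
  0 < x -> 0 < x + h -> -1 <= h <= 1 ->
  is_lim_seq (psum (fun j => ln_defect (h / (x + INR j))))
             (lnGamma (x + h) - lnGamma x - h * digamma x).
Proof.
intros hx hxh hh.
apply (is_lim_seq_ext (fun n => lnGamma (x + h) - lnGamma x - h * digamma_seq x n
    - shift_error (x + INR n) h)).
{ intros n. symmetry. now apply psum_ln_defect. }
replace (Finite (lnGamma (x + h) - lnGamma x - h * digamma x))
  with (Finite (lnGamma (x + h) - lnGamma x - h * digamma x - 0))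
  by (f_equal; ring).
apply is_lim_seq_minus'.
- apply is_lim_seq_minus'; [apply is_lim_seq_const|].
  apply (is_lim_seq_scal_l (digamma_seq x) h (digamma x)).
  now apply digamma_correct.
(* Skipping two terms makes the base point exceed 1, as [shift_error_bound] demands. *)
- apply is_lim_seq_abs_0. apply is_lim_seq_incr_n with (N := 2%nat).
  apply (is_lim_seq_le_le (fun _ => 0) _ (fun n => 2 / (x + 1 + INR n))).
  + intros n. split; [apply Rabs_pos|]. pose proof (pos_INR n).
    rewrite plus_INR. simpl (INR 2).
    eapply Rle_trans; [apply shift_error_bound; lra|].
    apply Req_le. f_equal. ring.
  + apply is_lim_seq_const.
  + apply is_lim_seq_const_over.
Qed.

(** For y = x + j the condition |h| <= x/2 gives 1/(y+h) <= 2/y, hence the factor 2. Comparing 1/y^2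
    with 1/y - 1/(y+1) costs 1 + 1/x, and telescoping leaves 1/x. *)
Lemma ln_defect_sum_bound (x h : R) :
  0 < x -> Rabs h <= x / 2 -> Rabs h <= 1 ->
  0 <= lnGamma (x + h) - lnGamma x - h * digamma x
    <= 2 * (1 + / x) / x * (h * h).
Proof.
intros hx hh h1.
apply Rabs_le_between in hh. apply Rabs_le_between in h1.
pose proof (ln_defect_sum x h hx ltac:(lra) ltac:(lra)) as hs.
assert (hix : 0 < / x) by now apply Rinv_0_lt_compat.
assert (hterm : forall j, -1 < h / (x + INR j)).
{ intros j. pose proof (pos_INR j).
  apply (Rmult_lt_reg_r (x + INR j)); [lra|].
  unfold Rdiv. rewrite Rmult_assoc, Rinv_l, Rmult_1_r by lra. lra. }
assert (hb : forall n, 0 <= psum (fun j => ln_defect (h / (x + INR j))) n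
  <= 2 * (1 + / x) * (h * h) * (/ x - / (x + INR n))).
{ induction n as [|n [IH1 IH2]].
  - simpl. rewrite Rplus_0_r. lra.
  - rewrite S_INR. simpl psum. pose proof (pos_INR n).
    pose proof (ln_defect_nonneg _ (hterm n)).
    split; [lra|].
    pose proof (ln_defect_le _ (hterm n)) as hd.
    set (y := x + INR n) in *. assert (hy : 0 < y) by (unfold y; lra).
    replace (x + (INR n + 1)) with (y + 1) by (unfold y; ring).
    assert (hiy : 0 < / y) by now apply Rinv_0_lt_compat.
    assert (e1 : h / y * (h / y) / (1 + h / y) <= 2 * (h * h) * (/ y * / y)).
    { replace (h / y * (h / y) / (1 + h / y)) with (h * h * (/ y * / (y + h)))
        by (field; unfold y in *; lra).
      assert (/ (y + h) <= 2 * / y).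
      { replace (2 * / y) with (/ (y / 2)) by (field; lra).
        apply Rinv_le_contravar; unfold y; lra. }
      assert (/ y * / (y + h) <= / y * (2 * / y)) by (apply Rmult_le_compat_l; lra).
      assert (0 <= h * h) by nra. nra. }
    assert (e2 : / y * / y <= (1 + / x) * (/ y - / (y + 1))).
    { replace (/ y - / (y + 1)) with (/ y * / (y + 1)) by (field; lra).
      replace (/ y * / y) with ((1 + / y) * (/ y * / (y + 1))) by (field; lra).
      apply Rmult_le_compat_r.
      - apply Rlt_le, Rmult_lt_0_compat; [lra|apply Rinv_0_lt_compat; lra].
      - assert (/ y <= / x) by (apply Rinv_le_contravar; unfold y; lra). lra. }
    apply (Rmult_le_compat_l (2 * (h * h))) in e2; [|nra]. lra. }
split.
- exact (is_lim_seq_le (fun _ => 0) _ 0 _ (fun n => proj1 (hb n))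
    (is_lim_seq_const 0) hs).
- refine (is_lim_seq_le _ (fun _ => 2 * (1 + / x) / x * (h * h)) _
    (2 * (1 + / x) / x * (h * h)) _ hs _).
  + intros n. eapply Rle_trans; [apply hb|]. pose proof (pos_INR n).
    assert (0 < / (x + INR n)) by (apply Rinv_0_lt_compat; lra).
    assert (0 <= 2 * (1 + / x) * (h * h)) by nra. unfold Rdiv. nra.
  + apply is_lim_seq_const.
Qed.

Lemma lnGamma_derive (x : R) : 0 < x -> is_derive lnGamma x (digamma x).
Proof.
intros hx. apply is_derive_Reals. intros eps heps.
set (K := 2 * (1 + / x) / x).
assert (hix : 0 < / x) by now apply Rinv_0_lt_compat.
assert (hK : 0 < K) by (unfold K, Rdiv; nra).
(* The first two entries admit [ln_defect_sum_bound]; the third makes the error K |h| of the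
   difference quotient smaller than [eps]. *)
assert (hd : 0 < Rmin (Rmin (x / 2) 1) (eps / K)).
{ repeat apply Rmin_glb_lt; try lra. now apply Rdiv_lt_0_compat. }
exists (mkposreal _ hd). intros h h0 hh. simpl in hh.
apply Rmin_Rgt_l in hh as [hh hh3]. apply Rmin_Rgt_l in hh as [hh1 hh2].
pose proof (ln_defect_sum_bound x h hx ltac:(lra) ltac:(lra)) as hb. fold K in hb.
assert (ha : 0 < Rabs h) by now apply Rabs_pos_lt.
replace ((lnGamma (x + h) - lnGamma x) / h - digamma x)
  with ((lnGamma (x + h) - lnGamma x - h * digamma x) / h) by (field; assumption).
unfold Rdiv. rewrite Rabs_mult, Rabs_inv, (Rabs_pos_eq _ (proj1 hb)).
apply (Rmult_lt_reg_r (Rabs h)); [assumption|].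
rewrite Rmult_assoc, Rinv_l, Rmult_1_r by lra.
eapply Rle_lt_trans; [apply hb|].
replace (h * h) with (Rabs h * Rabs h)
  by (rewrite <- Rabs_mult; apply Rabs_pos_eq; nra).
rewrite <- Rmult_assoc. apply Rmult_lt_compat_r; [assumption|].
rewrite Rmult_comm. apply (Rmult_lt_compat_r K) in hh3; [|assumption].
unfold Rdiv in hh3. rewrite Rmult_assoc, Rinv_l, Rmult_1_r in hh3 by lra.
exact hh3.
Qed.

(** Gamma is differentiated as exp of [lnGamma], an equality valid on the ball of radius x, where
    Gamma is positive. *)
Lemma Psi_digamma (x : R) : 0 < x -> Psi x = digamma x.
Proof.
intros hx. unfold Psi. pose proof (Gamma_pos x hx) as hG.
rewrite (is_derive_unique Gamma x (digamma x * Gamma x)).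
- field. lra.
- apply (is_derive_ext_loc (fun y => exp (lnGamma y))).
  + exists (mkposreal x hx). intros y hy. apply exp_ln, Gamma_pos.
    apply ball_R in hy; simpl in hy. lra.
  + rewrite <- (exp_ln (Gamma x)) by assumption. fold (lnGamma x).
    apply (is_derive_comp exp lnGamma); [apply is_derive_exp|].
    now apply lnGamma_derive.
Qed.

Lemma euler_gamma_digamma : euler_gamma = - digamma 1.
Proof.
unfold euler_gamma.
replace (- digamma 1) with (real (Finite (- digamma 1 + 0)))
  by (simpl; ring).
f_equal. apply is_lim_seq_unique.
(* With the same logarithm, the harmonic sum in [euler_gamma] has one term more than the sum in
   [digamma_seq]. *)
apply (is_lim_seq_ext (fun m => - digamma_seq 1 m + 1 / (1 + INR m))).
- intros m. rewrite sum_n_psum. unfold digamma_seq. cbn [psum].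
  rewrite (psum_ext (fun j => / (1 + INR j)) (fun k => / INR (S k)))
    by (intros k; rewrite S_INR; f_equal; ring).
  replace (1 + INR m) with (INR (S m)) by (rewrite S_INR; ring).
  unfold Rdiv. ring.
- apply is_lim_seq_plus'.
  + apply (is_lim_seq_opp (digamma_seq 1) (digamma 1)).
    now apply digamma_correct, Rlt_0_1.
  + apply is_lim_seq_const_over.
Qed.

(** * Summation by parts *)

(** Each period of length [q] contains the residue once; [hsub] follows the sum through a partial
    period. *)
Lemma psum_residue_class (f : nat -> R) (q r J : nat) :
  (r < q)%nat ->
  psum (fun m => if Nat.eq_dec (m mod q) r then f m else 0) (q * J)
  = psum (fun j => f (q * j + r)%nat) J.
Proof.
intros hr. induction J as [|J IH].
- rewrite Nat.mul_0_r. reflexivity.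
- rewrite Nat.mul_succ_r. simpl psum. rewrite <- IH.
  set (a := fun m => if Nat.eq_dec (m mod q) r then f m else 0).
  assert (hmod : forall i, (i < q)%nat -> ((q * J + i) mod q = i)%nat).
  { intros i hi. rewrite Nat.add_comm, Nat.mul_comm, Nat.Div0.mod_add.
    now apply Nat.mod_small. }
  assert (hsub : forall p, (p <= q)%nat -> psum a (q * J + p)
    = psum a (q * J) + if lt_dec r p then f (q * J + r)%nat else 0).
  { induction p as [|p IHp]; intros hp.
    - rewrite Nat.add_0_r. simpl. ring.
    - rewrite Nat.add_succ_r. simpl psum. rewrite IHp by lia. unfold a at 2.
      rewrite hmod by lia.
      destruct (Nat.eq_dec p r) as [e|n], (lt_dec r p), (lt_dec r (S p));
        try lia; rewrite ?e; ring. }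
  rewrite hsub by lia. destruct (lt_dec r q); [reflexivity|lia].
Qed.

(** Partial sums of nonnegative terms are monotone, so the one at n lies between those at q J0 and q
    n. *)
Lemma psum_nonneg_subseq (a : nat -> R) (q : nat) (l : R) :
  (1 <= q)%nat -> (forall k, 0 <= a k) ->
  is_lim_seq (fun J => psum a (q * J)) l -> is_lim_seq (psum a) l.
Proof.
intros hq ha h. apply is_lim_seq_spec. apply is_lim_seq_spec in h.
intros eps. destruct (h eps) as [J0 hJ]. exists (q * J0)%nat. intros n hn.
pose proof (hJ J0 (le_n _)) as h1.
assert (hJn : (J0 <= n)%nat) by nia.
pose proof (hJ n hJn) as h2. simpl in h1, h2.
pose proof (psum_incr a (q * J0) n ha hn).
pose proof (psum_incr a n (q * n) ha ltac:(nia)).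
apply Rabs_def2 in h1. apply Rabs_def2 in h2. apply Rabs_def1; lra.
Qed.

(** Index m stands for the integer m + 1, and u is the least positive integer congruent to v; u - 1
    is then a valid residue even for v = 0. *)
Lemma succ_mod_iff (q v u m : nat) :
  (v < q)%nat -> u = (if Nat.eq_dec v 0 then q else v) ->
  ((S m) mod q = v <-> m mod q = u - 1)%nat.
Proof.
intros hv hu.
pose proof (Nat.div_mod_eq m q) as e.
pose proof (Nat.mod_upper_bound m q ltac:(lia)) as hr.
set (a := (m / q)%nat) in *. set (r := (m mod q)%nat) in *. clearbody a r.
destruct (Nat.eq_dec (S r) q) as [hq|hq].
- replace (S m) with ((a + 1) * q)%nat by nia.
  rewrite Nat.Div0.mod_mul. subst u. destruct (Nat.eq_dec v 0); lia.
- replace (S m) with (S r + a * q)%nat by nia.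
  rewrite Nat.Div0.mod_add, Nat.mod_small by lia.
  subst u. destruct (Nat.eq_dec v 0); lia.
Qed.

(** With k = n + 1 the logarithms cancel because (1 + 1/(2k))(1 + 1/(2k+1)) = 1 + 1/k. *)
Lemma ln_defect_split (n : nat) :
  ln_defect (/ INR (S n)) - ln_defect (/ INR (S (2 * n + 1)))
  - ln_defect (/ INR (S (2 * n + 2)))
  = / (2 * INR (S n) * (2 * INR (S n) + 1)).
Proof.
pose proof (pos_INR n). unfold ln_defect.
rewrite !S_INR, !plus_INR, !mult_INR. simpl INR. set (x := INR n) in *.
replace (1 + / (x + 1)) with ((x + 2) / (x + 1)) by (field; lra).
replace (1 + / ((1 + 1) * x + 1 + 1)) with ((2 * x + 3) / (2 * (x + 1)))
  by (field; lra).
replace (1 + / ((1 + 1) * x + (1 + 1) + 1)) with (2 * (x + 2) / (2 * x + 3))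
  by (field; lra).
rewrite !ln_div, !ln_mult by lra. field. lra.
Qed.

(** Both 2n and 2n + 1 have half n, so the integers 1 to 2M + 1 exhaust those with half at most M.
    The correction collects N(n) g(n) for M < n <= 2M + 1. *)
Lemma psum_digit_recurrence (N : nat -> R) (M : nat) :
  N O = 0 ->
  psum (fun m => N (S m) / (2 * INR (S m) * (2 * INR (S m) + 1))) M
  = psum (fun m => (N (S m) - N (S m / 2)%nat) * ln_defect (/ INR (S m))) (2 * M + 1)
    - (psum (fun m => N (S m) * ln_defect (/ INR (S m))) (M + (M + 1))
       - psum (fun m => N (S m) * ln_defect (/ INR (S m))) M).
Proof.
intros h0. replace (M + (M + 1))%nat with (2 * M + 1)%nat by lia.
induction M as [|M IH].
- simpl. rewrite h0. ring.
- replace (2 * S M + 1)%nat with (S (S (2 * M + 1))) by lia.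
  cbn [psum]. rewrite IH. unfold Rdiv at 1. rewrite <- ln_defect_split.
  replace (S (2 * M + 1) / 2)%nat with (S M)
    by (apply (Nat.div_unique _ 2 (S M) 0); lia).
  replace (S (S (2 * M + 1)) / 2)%nat with (S M)
    by (apply (Nat.div_unique _ 2 (S M) 1); lia).
  replace (S (2 * M + 1)) with (2 * M + 2)%nat by lia. ring.
Qed.

(** There are M + 1 terms. In each, N is at most 4 sqrt (M+1) and the defect at most 1/(M+1)^2, for
    a total of at most 4/sqrt (M+1). *)
Lemma digit_tail_vanishes (N : nat -> R) :
  (forall m, (1 <= m)%nat -> 0 <= N m /\ N m * N m <= 4 * INR m) ->
  is_lim_seq (fun M =>
    psum (fun m => N (S m) * ln_defect (/ INR (S m))) (M + (M + 1))
    - psum (fun m => N (S m) * ln_defect (/ INR (S m))) M) 0.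
Proof.
intros hN. set (a := fun m => N (S m) * ln_defect (/ INR (S m))).
assert (hi : forall m, 0 < / INR (S m)).
{ intros m. apply Rinv_0_lt_compat. rewrite S_INR. pose proof (pos_INR m). lra. }
assert (ha : forall k, 0 <= a k).
{ intros k. apply Rmult_le_pos; [apply hN; lia|].
  apply ln_defect_nonneg. pose proof (hi k). lra. }
apply (is_lim_seq_le_le (fun _ => 0) _ (fun M => 4 * / sqrt (INR (S M)))).
- intros M. split.
  { pose proof (psum_incr a M (M + (M + 1)) ha ltac:(lia)). lra. }
  set (s := sqrt (INR (S M))).
  assert (hM : 0 < INR (S M)) by (rewrite S_INR; pose proof (pos_INR M); lra).
  assert (hs : 0 < s) by now apply sqrt_lt_R0.
  assert (hss : s * s = INR (S M)) by (apply sqrt_sqrt; lra).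
  replace (4 * / s) with (INR (M + 1) * (4 * s * (/ INR (S M) * / INR (S M)))).
  2: { rewrite Nat.add_1_r, <- hss. field. lra. }
  apply psum_block_le. intros k hk. unfold a.
  assert (hkM : INR (S M) <= INR (S k)) by (apply le_INR; lia).
  assert (hk4 : INR (S k) <= 4 * INR (S M)).
  { replace 4 with (INR 4) by (simpl; ring). rewrite <- mult_INR.
    apply le_INR. lia. }
  destruct (hN (S k) ltac:(lia)) as [hN0 hN1].
  apply Rmult_le_compat; [assumption| | |].
  + apply ln_defect_nonneg. pose proof (hi k). lra.
  + apply Rsqr_incr_0_var; [|lra]. unfold Rsqr.
    replace (4 * s * (4 * s)) with (16 * INR (S M)) by (rewrite <- hss; ring). lra.
  + pose proof (hi k) as hik.
    eapply Rle_trans; [apply ln_defect_le; lra|].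
    assert (hle : / INR (S k) <= / INR (S M)) by (apply Rinv_le_contravar; lra).
    apply Rle_trans with (/ INR (S k) * / INR (S k)).
    * unfold Rdiv. rewrite <- (Rmult_1_r (/ INR (S k) * / INR (S k))) at 2.
      apply Rmult_le_compat_l; [nra|]. rewrite <- Rinv_1.
      apply Rinv_le_contravar; lra.
    * apply Rmult_le_compat; lra.
- apply is_lim_seq_const.
- replace (Finite 0) with (Rbar_mult 4 0) by (simpl; f_equal; ring).
  apply (is_lim_seq_scal_l (fun M => / sqrt (INR (S M))) 4 0).
  replace (Finite 0) with (Rbar_inv p_infty) by reflexivity.
  apply is_lim_seq_inv; [|discriminate].
  apply (filterlim_comp _ _ _ (fun M => INR (S M)) sqrt _ (Rbar_locally' p_infty)).
  + apply (proj1 (is_lim_seq_incr_1 INR p_infty)), is_lim_seq_INR.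
  + apply filterlim_sqrt_p.
Qed.

(** Taking u as the least positive integer congruent to [v2 w] treats both parts of the theorem at
    once. *)
Lemma N2_series (w : word) (u : nat) :
  w <> nil ->
  u = (if Nat.eq_dec (v2 w) 0 then 2 ^ length w else v2 w)%nat ->
  is_series
    (fun m => INR (N2 w (S m)) / (2 * INR (S m) * (2 * INR (S m) + 1)))
    (lnGamma (INR u / 2 ^ length w + 1 / 2 ^ length w)
     - lnGamma (INR u / 2 ^ length w)
     - 1 / 2 ^ length w * digamma (INR u / 2 ^ length w)).
Proof.
intros hw hu. set (q := (2 ^ length w)%nat).
assert (hq : 2 ^ length w = INR q).
{ unfold q. rewrite pow_INR. reflexivity. }
rewrite hq.
assert (hv : (v2 w < q)%nat) by apply v2_lt.
assert (hu1 : (1 <= u <= q)%nat)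
  by (subst u; fold q; destruct (Nat.eq_dec (v2 w) 0); lia).
assert (hq1 : 1 <= INR q) by (apply (le_INR 1); lia).
assert (hu0 : 1 <= INR u) by (apply (le_INR 1); lia).
set (N := fun m => INR (N2_from_0 w m)).
set (g := fun m => ln_defect (/ INR (S m))).
set (l := lnGamma _ - _ - _).
apply is_series_psum.
apply (is_lim_seq_ext _ _ _ (fun M => eq_sym
  (psum_digit_recurrence N M eq_refl))).
replace l with (l - 0) by ring. apply is_lim_seq_minus'.
2: { apply digit_tail_vanishes. intros m hm. unfold N. split; [apply pos_INR|].
  replace 4 with (INR 4) by (simpl; ring). rewrite <- !mult_INR.
  apply le_INR. now apply N2_square_le. }
(* Only partial sums of odd length 2M + 1 occur, so convergence of the full sequence suffices. *)
apply (is_lim_seq_subseq (psum (fun m =>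
  (N (S m) - N (S m / 2)%nat) * ln_defect (/ INR (S m)))) l
  (fun M => (2 * M + 1)%nat)).
{ apply eventually_subseq. intros; lia. }
apply (is_lim_seq_ext
  (psum (fun m => if Nat.eq_dec (m mod q) (u - 1) then g m else 0))).
{ intros n. apply psum_ext. intros m. unfold N.
  rewrite (N2_half w (S m)) by (auto; lia). rewrite plus_INR. fold q.
  rewrite (indic_iff _ _ _ (Nat.eq_dec (m mod q) (u - 1)))
    by now apply succ_mod_iff.
  fold (g m). unfold indic. destruct (Nat.eq_dec (m mod q) (u - 1)); cbn [INR]; ring. }
apply (psum_nonneg_subseq _ q); [lia| |].
{ intros m. destruct (Nat.eq_dec (m mod q) (u - 1)); [|lra]. apply ln_defect_nonneg.
  assert (0 < / INR (S m)).
  { apply Rinv_0_lt_compat. rewrite S_INR. pose proof (pos_INR m). lra. }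
  lra. }
(* With h = 1/q and x = u/q, the reciprocal of q j + u is h/(x+j). *)
apply (is_lim_seq_ext (psum (fun j =>
  ln_defect ((1 / INR q) / (INR u / INR q + INR j))))).
{ intros J. rewrite psum_residue_class by lia. apply psum_ext. intros j.
  unfold g. f_equal. rewrite <- Nat.add_succ_r.
  replace (S (u - 1)) with u by lia. rewrite plus_INR, mult_INR.
  pose proof (pos_INR j). field. repeat split; nra. }
assert (0 < 1 / INR q <= 1).
{ unfold Rdiv. rewrite Rmult_1_l. split; [apply Rinv_0_lt_compat; lra|].
  rewrite <- Rinv_1. apply Rinv_le_contravar; lra. }
assert (0 < INR u / INR q) by (apply Rdiv_lt_0_compat; lra).
apply ln_defect_sum; lra.
Qed.

(* The sum over n >= 1 is indexed by n = S m. *)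
Theorem theorem1 (w : word) (hw : w <> nil) :
  (v2 w = 0%nat ->
   is_series
     (fun m : nat =>
        INR (N2 w (S m)) / (2 * INR (S m) * (2 * INR (S m) + 1)))
     (ln (Gamma (1 / 2 ^ length w)) + euler_gamma / 2 ^ length w
      - INR (length w) * ln 2))
  /\
  (v2 w <> 0%nat ->
   is_series
     (fun m : nat =>
        INR (N2 w (S m)) / (2 * INR (S m) * (2 * INR (S m) + 1)))
     (ln (Gamma ((INR (v2 w) + 1) / 2 ^ length w))
      - ln (Gamma (INR (v2 w) / 2 ^ length w))
      - 1 / 2 ^ length w * Psi (INR (v2 w) / 2 ^ length w))).
Proof.
assert (hq : 0 < 2 ^ length w) by (apply pow_lt; lra).
pose proof (N2_series w _ hw eq_refl) as h.
destruct (Nat.eq_dec (v2 w) 0) as [e|e]; split; intros hv; try contradiction.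
(* Here u = q and x = 1. The functional equation moves [lnGamma] from 1 + 1/q to 1/q, which produces
   ln (1/q) = -|w| ln 2. *)
- rewrite pow_INR in h. change (INR 2) with 2 in h. rewrite Rdiv_diag in h by lra.
  rewrite (Rplus_comm 1), lnGamma_succ in h by (apply Rdiv_lt_0_compat; lra).
  unfold lnGamma in h at 2. rewrite Gamma_1, ln_1 in h.
  rewrite ln_div, ln_1, ln_pow in h by lra.
  rewrite euler_gamma_digamma. fold (lnGamma (1 / 2 ^ length w)).
  replace (lnGamma (1 / 2 ^ length w) + - digamma 1 / 2 ^ length w
           - INR (length w) * ln 2)
    with (lnGamma (1 / 2 ^ length w) + (0 - INR (length w) * ln 2) - 0
          - 1 / 2 ^ length w * digamma 1) by (unfold Rdiv; ring).
  exact h.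
- assert (0 < INR (v2 w)) by (apply lt_0_INR; lia).
  rewrite Psi_digamma by (apply Rdiv_lt_0_compat; lra).
  rewrite Rdiv_plus_distr. exact h.
Qed.
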